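(* Suppose $n,s,q,a,b$ are integers satisfying $n\ge s\ge 2$, $a\ge 1$, and $q=a\binom{s}{2}+b$ with $0\le b\le s-2$. (Extremal) Then $$a^{\binom{n}{2}}\le \operatorname{ex}_{\Pi}(n,s,q)\le a^{\binom{n}{2}}\Big(\frac{a+1}{a}\Big)^{\lfloor \frac{b}{b+1}n\rfloor},$$ and thus $\operatorname{ex}_{\Pi}(s,q)=a$. Further: (a) If $b=0$, then $\mathcal{P}(n,s,q)=\{\mathbb{U}_a(n)\}$ and $\operatorname{ex}_{\Pi}(n,s,q)=a^{\binom{n}{2}}$. (b) If $b=s-2$, then $\mathbb{U}_{s-1,a}(n)\subseteq\mathcal{P}(n,s,q)$ and $\operatorname{ex}_{\Pi}(n,s,q)=a^{\binom{n}{2}}\big(\frac{a+1}{a}\big)^{\lfloor \frac{(s-2)n}{s-1}\rfloor}$. Also, when $s=3$ (and $b=s-2=1$), $\mathcal{P}(n,3,q)=\mathbb{U}_{2,a}(n)$. (Stability) For all $\delta>0$ there are $\epsilon>0$ and $M$ (depending on $s,q,a,b,\delta$) such that for all $n>M$ and all $G\in F(n,s,q)$, if $P(G)>\operatorname{ex}_{\Pi}(n,s,q)^{1-\epsilon}$, then $G$ is $\delta$-close to $\mathbb{U}_a(n)$.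
   Context: For a set $X$ and a positive integer $t$, $\binom{X}{t}$ is the set of $t$-element subsets of $X$; $[n]=\{1,\dots,n\}$; $\mathbb{N}=\{0,1,2,\dots\}$. A multigraph is a pair $G=(V,w)$ where $V$ is a (finite) set of vertices and $w:\binom{V}{2}\to\mathbb{N}$; $w(xy)$ is the multiplicity of $xy$. For integers $s\ge 2$, $q\ge 0$, $G=(V,w)$ is an $(s,q)$-graph if $\sum_{xy\in\binom{X}{2}}w(xy)\le q$ for every $X\in\binom{V}{s}$. $F(n,s,q)$ is the set of $(s,q)$-graphs with vertex set $[n]$. Let $P(G)=\prod_{xy\in\binom{V}{2}}w(xy)$, $\operatorname{ex}_{\Pi}(n,s,q)=\max\{P(G):G\in F(n,s,q)\}$ for $n\ge s$, and $\mathcal{P}(n,s,q)=\{G\in F(n,s,q):P(G)=\operatorname{ex}_{\Pi}(n,s,q)\}$. For $q\ge\binom{s}{2}$, $\operatorname{ex}_{\Pi}(s,q)=\lim_{n\to\infty}\operatorname{ex}_{\Pi}(n,s,q)^{1/\binom{n}{2}}$. For $X\subseteq V$, $G[X]$ is the multigraph $(X,w|_{\binom{X}{2}})$. Two multigraphs $G=(V,w)$, $G'=(V,w')$ with $|V|=n$ are $\delta$-close if $|\{xy\in\binom{V}{2}:w(xy)\ne w'(xy)\}|\le\delta n^2$. For integers $n\ge r\ge 1$ and $a\ge 1$, $\mathbb{U}_{r,a}(n)$ is the set of multigraphs $G=([n],w)$ for which there is a partition $A_0,A_1,\dots,A_{\lfloor n/r\rfloor}$ of $[n]$ ($A_0$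 possibly empty) such that: $|A_i|=r$ for $1\le i\le\lfloor n/r\rfloor$ and $|A_0|=n-r\lfloor n/r\rfloor$; for each $0\le i\le\lfloor n/r\rfloor$ (with $A_i\neq\emptyset$), $G[A_i]$ is a star with $|A_i|-1$ edges of multiplicity $a+1$ (i.e. the pairs of multiplicity $a+1$ inside $A_i$ form a spanning star of $A_i$) and all other pairs inside $A_i$ have multiplicity $a$; and $w(xy)=a$ for all $xy\notin\bigcup_i\binom{A_i}{2}$. $\mathbb{U}_a(n)$ denotes the unique element of $\mathbb{U}_{1,a}(n)$, i.e. $\mathbb{U}_a(n)=([n],w)$ with $w(xy)=a$ for all $xy\in\binom{[n]}{2}$. *)

(* Defs.v *)
From mathcomp Require Import all_boot all_order all_algebra.
From mathcomp Require Import all_classical all_reals all_analysis.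
Import Order.TTheory GRing.Theory Num.Theory numFieldNormedType.Exports.

Set Implicit Arguments.
Unset Strict Implicit.
Unset Printing Implicit Defensive.

Local Open Scope classical_set_scope.
Local Open Scope nat_scope.

Definition vpair (T : finType) := {e : {set T} | #|e| == 2}.

(* A multigraph on T is its multiplicity function; since the domain consists of
   the 2-element subsets only, equality of multigraphs is Leibniz equality. *)
Definition multigraph (T : finType) := {ffun vpair T -> nat}.

Definition edge_sum (T : finType) (G : multigraph T) (X : {set T}) : nat :=
  \sum_(e : vpair T | val e \subset X) G e.

Definition edge_prod (T : finType) (G : multigraph T) : nat :=
  \prod_(e : vpair T) G e.

Definition sq_graph (T : finType) (s q : nat) (G : multigraph T) : Prop :=
  forall X : {set T}, #|X| = s -> edge_sum G X <= q.

(* The vertex set [n] is rendered as 'I_n. *)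
Definition sq_graphs (n s q : nat) : set (multigraph 'I_n) :=
  [set G | sq_graph s q G].
Arguments sq_graphs : clear implicits.

(* The maximum of [edge_prod] over [sq_graphs n s q]. It exists when
   2 <= s <= n, see [ex_prod_max]; the default value 0 is irrelevant there. *)
Definition ex_prod (n s q : nat) : nat :=
  xget 0 [set m | (exists2 G, sq_graphs n s q G & edge_prod G = m) /\
                  (forall G, sq_graphs n s q G -> edge_prod G <= m)].

Definition extremal_graphs (n s q : nat) : set (multigraph 'I_n) :=
  [set G | sq_graphs n s q G /\ edge_prod G = ex_prod n s q].
Arguments extremal_graphs : clear implicits.

Definition ex_prod_root (R : realType) (s q : nat) : nat -> R :=
  fun n => ((ex_prod n s q)%:R `^ ('C(n, 2)%:R)^-1)%R.

Definition ex_prod_limit (R : realType) (s q : nat) : R :=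
  limn (ex_prod_root R s q).

Definition edit_distance (T : finType) (G H : multigraph T) : nat :=
  #|[pred e : vpair T | G e != H e]|.

Definition delta_close (R : realType) (delta : R) (T : finType)
    (G H : multigraph T) : Prop :=
  ((edit_distance G H)%:R <= delta * #|T|%:R ^+ 2)%R.

(* The pairs inside A have multiplicity a.+1 if they contain the centre c, and
   a otherwise; for #|A| = 1 there is no constraint. *)
Definition spanning_star (T : finType) (a : nat) (G : multigraph T)
    (A : {set T}) : Prop :=
  exists2 c : T, c \in A &
    forall e : vpair T, val e \subset A -> G e = if c \in val e then a.+1 else a.

Definition U_graphs (r a n : nat) : set (multigraph 'I_n) :=
  [set G | exists A : 'I_(n %/ r).+1 -> {set 'I_n},
    [/\ (forall i j, i != j -> A i :&: A j = finset.set0) /\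
          (forall x, exists i, x \in A i),
        #|A ord0| = n - r * (n %/ r) /\ (forall i, i != ord0 -> #|A i| = r),
        forall i, A i != finset.set0 -> spanning_star a G (A i)
      & forall e : vpair 'I_n, (forall i, ~~ (val e \subset A i)) -> G e = a]].
Arguments U_graphs : clear implicits.

Definition U_graph (a n : nat) : multigraph 'I_n := [ffun=> a].

Lemma ex_prod_max (n s q : nat) : 2 <= s <= n ->
  (exists2 G, sq_graphs n s q G & edge_prod G = ex_prod n s q) /\
  (forall G, sq_graphs n s q G -> edge_prod G <= ex_prod n s q).
Proof.
move=> /andP[s2 sn].
have bnd G : sq_graphs n s q G -> edge_prod G <= q ^ #|{: vpair 'I_n}|.
  move=> FG; rewrite /edge_prod -prod_nat_const; apply: leq_prod => e _.
  have eC : s - 2 <= #|~: val e|.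
    by rewrite cardsCs finset.setCK card_ord (eqP (valP e)) leq_sub2r.
  have /set0Pn[B] : [set B : {set 'I_n} | (B \subset ~: val e) & #|B| == s - 2]%SET
      != finset.set0.
    by rewrite -card_gt0 cards_draws bin_gt0.
  rewrite inE => /andP[sB /eqP cB].
  have dB : (val e :&: B)%SET = finset.set0.
    by apply/eqP; rewrite finset.setIC finset.setI_eq0 finset.disjoints_subset.
  have cX : #|val e :|: B| = s.
    by rewrite cardsU dB cards0 subn0 (eqP (valP e)) cB subnKC.
  apply: leq_trans (FG _ cX).
  by rewrite /edge_sum (bigD1 e) ?finset.subsetUl //= leq_addr.
pose Q m := `[<exists2 G, sq_graphs n s q G & edge_prod G = m>].
have exQ : exists m, Q m.
  exists (edge_prod (U_graph 0 n)); apply/asboolP; exists (U_graph 0 n) => //.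
  by move=> X _; rewrite /edge_sum big1 // => e _; rewrite ffunE.
have ubQ m : Q m -> m <= q ^ #|{: vpair 'I_n}|.
  by move=> /asboolP[G FG <-]; exact: bnd.
case: (ex_maxnP exQ ubQ) => m /asboolP Qm maxm.
apply: (@xgetI _ 0 [set m | (exists2 G, sq_graphs n s q G & edge_prod G = m) /\
  (forall G, sq_graphs n s q G -> edge_prod G <= m)] m); split=> // G FG.
by apply: maxm; apply/asboolP; exists G.
Qed.

(* Main.v *)
Require Import Defs.
From mathcomp Require Import all_boot all_order all_algebra.
From mathcomp Require Import all_classical all_reals all_analysis.
From mathcomp Require Import zify ring lra.
Import Order.TTheory GRing.Theory Num.Theory numFieldNormedType.Exports.

Local Open Scope classical_set_scope.
Local Open Scope ring_scope.

(** Write w = a + u with u integer valued, N = 'C(n, 2), c = (a + 1) / a and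
    f = floor (b n / (b + 1)).  Everything follows from a bound on sums:
    an (s, a 'C(s, 2) + b)-graph with b <= s - 2 on n >= s vertices has total
    excess u(V) <= f ([pair_sum_le], [sq_graph_edge_sum]).

    - For s <= n <= 2s - 2 this is obtained by averaging over the deletion of
      one vertex, which gives u(V) <= n + b - s.
    - For n >= 2s - 1, in a minimal counterexample every non-empty set X with
      fewer than s vertices satisfies u(V) - u(V \ X) > floor (b |X| / (b + 1)), so that
      some vertex outside X has a large degree to X.  Adding such vertices one
      at a time gives sets of size k and excess at least min(k - 1, b + 1), and
      for k = s this contradicts the hypothesis on s-sets.

    The upper bound on products then comes from the integer inequality
    w <= a c^(w - a), which is an equality exactly for w in {a, a + 1}
    ([mult_le_pow]): multiplied over all pairs it gives P(G) <= a^N c^f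
    ([sq_graph_edge_prod]), with equality iff all multiplicities are a or
    a + 1 and the total excess is f.  For b = 0 this forces all multiplicities
    to be a.

    Stability uses the tangent in place of the chord.  One has
    w <= a exp((w - a) / a), with a further factor kappa > 1 to spare as soon
    as w <> a ([mult_le_exp]).  Hence P(G) kappa^D <= a^N exp(n), where D is the
    number of pairs of multiplicity other than a ([edge_prod_le_exp]); comparing
    with P(G) > a^(N (1 - eps)) bounds D by a small multiple of n^2.  The same
    inequality gives the limit.

    For b = s - 2, a graph of U_(s-1,a)(n) is encoded by the idempotent map h
    sending a vertex to the centre of its block.  The pairs of multiplicity
    a + 1 inside X are the {x, h x} with x and h x distinct in X, and there are
    at most s - 2 of them in an s-set because no block has more than s - 1
    vertices ([star_graph_sq]); in total there are n minus the number of
    centres, that is f.  For s = 3 the equality case says that the pairs of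
    multiplicity a + 1 form a matching with floor (n / 2) pairs
    ([extremal_graphs3]). *)

(** * Weighted sums over the pairs inside a vertex set *)

(** The total weight of the pairs inside X, for integer weights u that may be
    negative. *)
Definition pair_sum {T : finType} (u : vpair T -> int) (X : {set T}) : int :=
  \sum_(e : vpair T | val e \subset X) u e.

Lemma vpairP {T : finType} (e : vpair T) :
  exists x y : T, x != y /\ val e = [set x; y]%SET.
Proof. by case/cards2P: (valP e) => x [y [xy ->]]; exists x, y. Qed.

Lemma card_vpair_sub {T : finType} (X : {set T}) :
  #|[pred e : vpair T | val e \subset X]| = 'C(#|X|, 2).
Proof.
rewrite -cards_draws -(card_imset _ val_inj); apply: eq_card => B.
rewrite [in RHS]inE; apply/imsetP/andP => [[e]|[BX B2]].
  by rewrite inE => eX ->; split=> //; exact: (valP e).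
by exists (Sub B B2) => //; rewrite inE SubK.
Qed.

Lemma pair_sum_small {T : finType} (u : vpair T -> int) (X : {set T}) :
  (#|X| <= 1)%N -> pair_sum u X = 0.
Proof.
move=> X1; rewrite /pair_sum big_pred0 // => e; apply/negP => /subset_leq_card.
by rewrite (eqP (valP e)); lia.
Qed.

Lemma pair_sum_rem {T : finType} (u : vpair T -> int) (X : {set T}) :
  \sum_(v in X) pair_sum u (X :\ v) = (#|X|%:Z - 2) * pair_sum u X.
Proof.
rewrite /pair_sum mulr_sumr.
have E v : v \in X -> \sum_(e : vpair T | val e \subset X :\ v) u e =
   \sum_(e : vpair T | val e \subset X) (if v \notin val e then u e else 0).
  move=> vX; rewrite [RHS]big_mkcond [LHS]big_mkcond /=; apply: eq_bigr => e _.
  by rewrite finset.subsetD1; do 2 case: ifP; case: (v \in val e); case: (val e \subset X).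
rewrite (eq_bigr _ E) exchange_big /=; apply: eq_bigr => e eX.
rewrite -big_mkcondr /=.
rewrite (eq_bigl (mem (X :\: val e))); last first.
  by move=> v; rewrite !inE andbC; case: (v \in X); case: (v \in sval e).
rewrite sumr_const cardsD (finset.setIidPr eX) (eqP (valP e)) -[LHS]mulr_natl.
have := subset_leq_card eX; rewrite (eqP (valP e)) => ?; congr (_ * _); lia.
Qed.

(** Both sides are the total weight of the pairs joining X to Y minus X. *)
Lemma pair_sum_cross {T : finType} (u : vpair T -> int) (X Y : {set T}) :
  X \subset Y ->
  \sum_(v in Y :\: X) (pair_sum u (v |: X) - pair_sum u X) =
  pair_sum u Y - pair_sum u X - pair_sum u (Y :\: X).
Proof.
move=> XY; pose i (Z : {set T}) (e : vpair T) : int := (val e \subset Z)%:Z.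
have E Z : pair_sum u Z = \sum_e i Z e * u e.
  rewrite /pair_sum big_mkcond /=; apply: eq_bigr => e _.
  by rewrite /i; case: (_ \subset _); rewrite ?mul1r ?mul0r.
rewrite !E.
have -> : \sum_(v in Y :\: X) (pair_sum u (v |: X) - \sum_e i X e * u e) =
   \sum_e \sum_(v in Y :\: X) (i (v |: X) e - i X e) * u e.
  rewrite exchange_big /=; apply: eq_bigr => v _.
  by rewrite E -sumrB; apply: eq_bigr => e _; rewrite mulrBl.
rewrite -!sumrB; apply: eq_bigr => e _; rewrite -mulr_suml -!mulrBl; congr (_ * _).
rewrite /i; have [x [y [xy ->]]] := vpairP e.
have sub2 (Z : {set T}) : ([set x; y]%SET \subset Z) = (x \in Z) && (y \in Z).
  by rewrite finset.subUset !finset.sub1set.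
have one (z : T) : z \notin X ->
    \sum_(v in Y :\: X) ((z == v)%:Z - 0) = (z \in Y)%:Z :> int.
  move=> zX; have [zY|zY] := boolP (z \in Y).
    rewrite (bigD1 z) ?inE ?zX ?zY //= eqxx big1 ?subr0 ?addr0 // => v /andP[_].
    by rewrite eq_sym subr0 => /negbTE ->.
  rewrite big1 // => v; rewrite !inE => /andP[_ vY].
  by case: eqVneq => // zv; move: zY; rewrite zv vY.
(* The coefficients of the pair {x, y} agree in each of the four positions of
   x and y relative to X. *)
rewrite !sub2; under eq_bigr do rewrite sub2 !inE.
rewrite !inE; have [xX|xX] := boolP (x \in X); have [yX|yX] := boolP (y \in X) => /=.
- rewrite (fintype.subsetP XY _ xX) (fintype.subsetP XY _ yX) big1 // => v _.
  by rewrite !orbT.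
- rewrite (fintype.subsetP XY _ xX) -[in RHS](one y yX) !subr0; apply: eq_bigr => v _.
  by rewrite orbT orbF.
- rewrite (fintype.subsetP XY _ yX) andbT andbF -[in RHS](one x xX) !subr0.
  by apply: eq_bigr => v _; rewrite orbT orbF andbT.
- rewrite subr0 subrr big1 // => v _; rewrite !orbF.
  by case: eqVneq => [<-|//]; rewrite eq_sym (negbTE xy).
Qed.

(** Averaging over vertex deletions, by induction on the size of Y.  The bound
    |Y| + b - s is propagated because it is at most |Y| - 2. *)
Lemma pair_sum_average {T : finType} (u : vpair T -> int) (s b : nat) :
  (b + 2 <= s)%N ->
  (forall X : {set T}, #|X| = s -> pair_sum u X <= b%:Z) ->
  forall Y : {set T}, (s <= #|Y|)%N ->
    pair_sum u Y <= #|Y|%:Z + b%:Z - s%:Z /\ (b = 0%N -> pair_sum u Y <= 0).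
Proof.
move=> bs hX Y; move: {2}(#|Y|) (erefl #|Y|) => n; elim: n Y => [|n IH] Y Yn sY.
  lia.
have [Es|ns] := eqVneq s #|Y|.
  by have := hX Y (esym Es); split; lia.
have ge2 : (2 <= #|Y|)%N by lia.
have cD v : v \in Y -> #|Y :\ v| = n.
  by move=> vY; have := cardsD1 v Y; rewrite vY; lia.
have bnd (M : int) : (forall v, v \in Y -> pair_sum u (Y :\ v) <= M) ->
    (#|Y|%:Z - 2) * pair_sum u Y <= #|Y|%:Z * M.
  move=> hM; rewrite -pair_sum_rem.
  have -> : #|Y|%:Z * M = \sum_(v in Y) M.
    by rewrite sumr_const -mulr_natl; congr (_ * _); lia.
  exact: ler_sum.
have IH1 v : v \in Y -> pair_sum u (Y :\ v) <= n%:Z + b%:Z - s%:Z.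
  by move=> vY; case: (IH _ (cD _ vY)); rewrite cD //; lia.
split.
  have := bnd _ IH1; rewrite Yn; set p := pair_sum u Y => H.
  have [//|lt] := lerP p (n.+1%:Z + b%:Z - s%:Z); nia.
move=> b0; have IH0 v : v \in Y -> pair_sum u (Y :\ v) <= 0.
  by move=> vY; case: (IH _ (cD _ vY)); rewrite ?cD //; lia.
by have := bnd _ IH0; nia.
Qed.

(** Growth by one vertex: the hypothesis on Y says that the weight inside X
    plus the weight from X to the rest of Y is at least t, so a best vertex
    outside X brings the weight up to t. *)
Lemma pair_sum_extend {T : finType} (u : vpair T -> int) (X Y : {set T}) (t : int) :
  X \subset Y -> (#|X| < #|Y|)%N -> t - 1 <= pair_sum u X ->
  t <= pair_sum u Y - pair_sum u (Y :\: X) ->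
  exists2 v, v \in Y :\: X & t <= pair_sum u (v |: X).
Proof.
move=> XY cXY tX tY.
have [/exists_inP //|/exists_inPn H] :=
  boolP [exists v in Y :\: X, t <= pair_sum u (v |: X)].
exfalso.
have /set0Pn[v vD] : (Y :\: X != finset.set0).
  by rewrite -card_gt0 cardsD (finset.setIidPr XY) subn_gt0.
have := pair_sum_cross u X Y XY; rewrite (bigD1 v vD) /=.
have : \sum_(i in Y :\: X | i != v) (pair_sum u (i |: X) - pair_sum u X) <= 0.
  by apply: sumr_le0 => i /andP[iD _]; have := H i iD; rewrite -ltNge; lia.
by move: (\sum_(i in _ | _) _) (H v vD) => r; rewrite -ltNge; lia.
Qed.

(** The extremal excess floor (b n / (b + 1)). *)
Definition extra (b n : nat) : nat := (b * n) %/ b.+1.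

Lemma leq_extra (b m n : nat) : (m <= extra b n)%N = (m * b.+1 <= b * n)%N.
Proof. exact: leq_divRL. Qed.

Lemma extra_ge (b n : nat) : (minn n b.+1 <= (extra b n).+1)%N.
Proof.
have [n0|n1] := posnP (minn n b.+1); first by rewrite n0.
by rewrite -(prednK n1) ltnS leq_extra; have [?|?] := leqP n b.+1; nia.
Qed.

Lemma extraD (b m n : nat) : (extra b m + extra b n <= extra b (m + n))%N.
Proof. by rewrite leq_extra mulnDr mulnDl leq_add // -leq_extra. Qed.

(** In this range of n the averaging bound implies the sharp one. *)
Lemma extra_ge_window (s b n : nat) :
  (b + 2 <= s)%N -> (0 < b)%N -> (s <= n <= 2 * s - 2)%N ->
  (n + b <= extra b n + s)%N.
Proof.
move=> bs b0 /andP[sn ns].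
suff : (n + b - s <= extra b n)%N by lia.
rewrite leq_extra; have [t sE] : exists t, s = (b + 2 + t)%N by exists (s - (b + 2))%N; lia.
have [p nE] : exists p, n = (s + p)%N by exists (n - s)%N; lia.
have -> : (n + b - s = p + b)%N by lia.
have : (t <= b * t)%N by rewrite leq_pmull.
have : (p <= b + t)%N by lia.
by rewrite nE sE !mulnDr !mulnDl; clear; nia.
Qed.

(** The sharp bound on weighted sums; the weights may be arbitrarily negative. *)
Lemma pair_sum_le {T : finType} (u : vpair T -> int) (s b : nat) :
  (b + 2 <= s)%N ->
  (forall X : {set T}, #|X| = s -> pair_sum u X <= b%:Z) ->
  forall Y : {set T}, (s <= #|Y|)%N -> pair_sum u Y <= (extra b #|Y|)%:Z.
Proof.
move=> bs hX Y; have [n] := ubnP #|Y|; elim: n Y => // n IH Y Yn sY.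
have [avg avg0] := pair_sum_average u s b bs hX Y sY.
have [b0|b0] := posnP b; first exact: le_trans (avg0 b0) _.
have [small|large] := leqP #|Y| (2 * s - 2).
  have := extra_ge_window s b #|Y| bs b0; rewrite sY small => /(_ isT).
  by move: avg; lia.
rewrite leNgt; apply/negP => big.
(* Y is now a minimal counterexample.  Its subsets of size at least s satisfy
   the bound, and those include all the complements Y :\: X used below since
   #|X| < s and 2 * s - 1 <= #|Y|. *)
have grow k : (k < s)%N -> exists2 X : {set T}, X \subset Y &
    #|X| = k.+1 /\ (minn k b.+1)%:Z <= pair_sum u X.
  elim: k => [_|k IHk ks].
    have /set0Pn[x xY] : (Y != finset.set0) by rewrite -card_gt0; lia.
    exists [set x]%SET; first by rewrite finset.sub1set.
    by rewrite cards1 pair_sum_small ?cards1 // min0n.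
  have [X XY [Xk gX]] := IHk (ltnW ks).
  have cD : #|Y :\: X| = (#|Y| - k.+1)%N by rewrite cardsD (finset.setIidPr XY) Xk.
  have kY : (k.+1 + (#|Y| - k.+1))%N = #|Y| by lia.
  have IHD : pair_sum u (Y :\: X) <= (extra b (#|Y| - k.+1))%:Z.
    by rewrite -cD; apply: IH; rewrite cD; lia.
  have := extraD b k.+1 (#|Y| - k.+1); have := extra_ge b k.+1; rewrite kY => fk sup.
  have [|||v vD gv] := pair_sum_extend u X Y (minn k.+1 b.+1)%:Z XY.
  - by rewrite Xk; lia.
  - by move: gX; lia.
  - by move: big IHD sup fk; lia.
  exists (v |: X); move: vD; rewrite finset.inE => /andP[vX vY].
    by rewrite finset.subUset finset.sub1set vY.
  by rewrite cardsU1 vX Xk.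
have [X _ [Xs gX]] := grow s.-1 ltac:(lia).
have sX : #|X| = s by rewrite Xs; lia.
by move: (hX X sX) gX bs; lia.
Qed.

(** * From sums to products *)

(** The signed excess of the multiplicities over a. *)
Definition excess {T : finType} (a : nat) (G : multigraph T) (e : vpair T) : int :=
  (G e)%:Z - a%:Z.

Lemma pair_sum_excess {T : finType} (a : nat) (G : multigraph T) (X : {set T}) :
  pair_sum (excess a G) X = (edge_sum G X)%:Z - (a * 'C(#|X|, 2))%N%:Z.
Proof.
rewrite /pair_sum /excess sumrB /edge_sum -[Posz (\sum_(_ | _) _)]natz natr_sum.
congr (_ - _).
  by apply: eq_bigr => e _; rewrite natz.
by rewrite sumr_const -card_vpair_sub mulnC PoszM pmulrn mulrzz mulrC.
Qed.

Lemma pair_sum_excess_le {T : finType} (s a b : nat) (G : multigraph T) :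
  sq_graph s (a * 'C(s, 2) + b) G ->
  forall X : {set T}, #|X| = s -> pair_sum (excess a G) X <= b%:Z.
Proof. by move=> GF X Xs; rewrite pair_sum_excess Xs; have := GF X Xs; lia. Qed.

Lemma card_vpair (T : finType) : #|{: vpair T}| = 'C(#|T|, 2).
Proof.
rewrite -cardsT -card_vpair_sub; apply: eq_card => e.
by rewrite !inE finset.subsetT.
Qed.

Lemma edge_sum_setT {T : finType} (G : multigraph T) :
  edge_sum G finset.setT = (\sum_e G e)%N.
Proof. by apply: eq_bigl => e; rewrite finset.subsetT. Qed.

Lemma sq_graph_edge_sum {T : finType} (s a b : nat) (G : multigraph T) :
  (2 <= s <= #|T|)%N -> (b <= s - 2)%N ->
  sq_graph s (a * 'C(s, 2) + b) G ->
  (\sum_e G e <= a * 'C(#|T|, 2) + extra b #|T|)%N.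
Proof.
move=> /andP[s2 sT] bs GF.
have := pair_sum_le (excess a G) s b _ (pair_sum_excess_le s a b G GF) finset.setT.
rewrite pair_sum_excess cardsT edge_sum_setT; lia.
Qed.

(** In log scale, this is the comparison of the concave function log with its
    chord through a and a + 1, which lies above it at all other integers. *)
Lemma mult_le_pow (R : realFieldType) (a w : nat) (c := a.+1%:R / a%:R :> R) :
  (0 < a)%N ->
  w%:R * c ^+ a <= a%:R * c ^+ w ?= iff ((w == a) || (w == a.+1)).
Proof.
move=> a0; have a0R : 0 < a%:R :> R by rewrite ltr0n.
have c0 : 0 < c by rewrite divr_gt0 ?ltr0n.
have ac : a%:R * c = a%:R + 1 by rewrite /c mulrCA divff ?gt_eqF // mulr1 -natr1.
suff [le lt] : w%:R * c ^+ a <= a%:R * c ^+ w /\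
    ((w != a) && (w != a.+1) -> w%:R * c ^+ a < a%:R * c ^+ w).
  split=> //; case: (eqVneq w a) => [->|wa] /=; first by rewrite eqxx.
  case: (eqVneq w a.+1) => [->|wa1] /=; last by apply: lt_eqF; apply: lt; rewrite wa wa1.
  by rewrite exprS mulrA ac natr1 eqxx.
have ca0 : 0 < c ^+ a by rewrite exprn_gt0.
have [wa|aw] := leqP w a.
  have -> : w = (a - (a - w))%N by lia.
  have : (a - w <= a)%N by lia.
  elim: (a - w)%N => [_|k IH ka]; first by rewrite subn0 lexx eqxx.
  have {IH} [le _] := IH (ltnW ka).
  suff lt : (a - k.+1)%:R * c ^+ a < a%:R * c ^+ (a - k.+1) by rewrite ltW.
  rewrite -(ltr_pM2r c0) -[ltRHS]mulrA -exprSr.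
  have -> : (a - k.+1).+1 = (a - k)%N by lia.
  apply: lt_le_trans le; rewrite mulrAC ltr_pM2r // -(ltr_pM2r a0R).
  rewrite -mulrA [c * _]mulrC ac natr1 -!natrM ltr_nat; nia.
have -> : w = (a + (w - a).-1.+1)%N by lia.
elim: (w - a)%N.-1 => [|k [le _]].
  by rewrite addn1 exprS mulrA ac natr1 lexx eqxx andbF.
suff lt : (a + k.+2)%:R * c ^+ a < a%:R * c ^+ (a + k.+2) by rewrite ltW.
have : (a + k.+1)%:R * c ^+ a * c <= a%:R * c ^+ (a + k.+2).
  by rewrite [(a + k.+2)%N]addnS exprSr mulrA ler_pM2r.
apply: lt_le_trans; rewrite mulrAC ltr_pM2r // -(ltr_pM2r a0R).
rewrite -mulrA [c * _]mulrC ac natr1 -!natrM ltr_nat; nia.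
Qed.

Lemma edge_prod_leif (R : realFieldType) (T : finType) (a : nat) (G : multigraph T)
    (N := 'C(#|T|, 2)) (c := a.+1%:R / a%:R :> R) :
  (0 < a)%N ->
  (edge_prod G)%:R * c ^+ (a * N) <= a%:R ^+ N * c ^+ (\sum_e G e)%N
    ?= iff [forall e, (G e == a) || (G e == a.+1)].
Proof.
move=> a0; have a0R : 0 < a%:R :> R by rewrite ltr0n.
have c0 : 0 < c by rewrite divr_gt0 ?ltr0n.
have := @leif_pprod R (vpair T) xpredT (fun e => (G e == a) || (G e == a.+1))
  (fun e => (G e)%:R * c ^+ a) (fun e => a%:R * c ^+ G e).
case=> [e _|e _|].
- by rewrite mulr_ge0 // exprn_ge0 // ltW.
- exact: mult_le_pow.
rewrite /= !big_split /= !prodr_const card_vpair -natr_prod -expr_sum -exprM.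
by rewrite mulf_eq0 !expf_eq0 ![_ == 0]gt_eqF // !andbF.
Qed.

Lemma sq_graph_edge_prod (R : realFieldType) (T : finType) (s a b : nat)
    (G : multigraph T) (N := 'C(#|T|, 2)) (c := a.+1%:R / a%:R :> R) :
  (0 < a)%N -> (2 <= s <= #|T|)%N -> (b <= s - 2)%N ->
  sq_graph s (a * 'C(s, 2) + b) G ->
  (edge_prod G)%:R <= a%:R ^+ N * c ^+ extra b #|T|
    ?= iff [forall e, (G e == a) || (G e == a.+1)] &&
           ((\sum_e G e)%N == (a * N + extra b #|T|)%N).
Proof.
move=> a0 sT bs GF; have a0R : 0 < a%:R :> R by rewrite ltr0n.
have c1 : 1 < c by rewrite ltr_pdivlMr // mul1r ltr_nat.
have c0 : 0 < c by apply: lt_trans c1.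
rewrite -(mono_leif (ler_pM2r (exprn_gt0 (a * N) c0))).
apply: leif_trans (edge_prod_leif R T a G a0) _.
rewrite -mulrA -exprD addnC (mono_leif (ler_pM2l (exprn_gt0 N a0R))).
split.
  by rewrite ler_eXn2l //; exact: (sq_graph_edge_sum s).
by rewrite (inj_eq (ieexprIn c0 (negbT (gt_eqF c1)))).
Qed.

(** The tangent inequality with an explicit gap kappa.  With x = (w - a) / a the
    gap comes from exp x >= (1 + x / 2)^2 = 1 + x + x^2 / 4, and the integrality
    of w enters through w <= (a + 1) (w - a)^2, valid for w <> a. *)
Lemma mult_le_exp (R : realType) (a w : nat)
    (kappa := 1 + (4 * a * a.+1)%:R^-1 :> R) :
  (0 < a)%N ->
  w%:R * (if w == a then 1 else kappa) <= a%:R * expR ((w%:R - a%:R) / a%:R).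
Proof.
move=> a0; have a0R : 0 < a%:R :> R by rewrite ltr0n.
have [->|wa] := eqVneq w a; first by rewrite subrr mul0r expR0.
set x := (_ / _); have wE : w%:R = a%:R * (1 + x).
  by rewrite /x mulrDr mulr1 mulrCA divff ?gt_eqF // mulr1 addrC subrK.
rewrite wE -mulrA ler_pM2l //.
have x1 : 0 <= 1 + x by rewrite -(pmulr_rge0 _ a0R) -wE.
have : (1 + x / 2) ^+ 2 <= expR x.
  have -> : expR x = expR (x / 2) ^+ 2 by rewrite -expRM_natl mulrC divfK.
  by apply: lerXn2r; rewrite ?nnegrE ?expR_ge0 ?expR_ge1Dx //; lra.
apply: le_trans.
suff : (1 + x) / (a%:R * a.+1%:R) <= x ^+ 2.
  rewrite /kappa !natrM -[4%:R]/(4 : R) => h.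
  have -> : (1 + x) * (1 + (4 * a%:R * a.+1%:R)^-1) =
     1 + x + (1 + x) / (a%:R * a.+1%:R) / 4.
    by field; rewrite !gt_eqF // ltr0n.
  by move: h; set y := _ / _; nra.
rewrite ler_pdivrMr ?mulr_gt0 ?ltr0n // -(ler_pM2l a0R) -wE.
have -> : a%:R * (x ^+ 2 * (a%:R * a.+1%:R)) = (w%:R - a%:R) ^+ 2 * a.+1%:R.
  by rewrite /x; field; rewrite gt_eqF.
have [aw|wa'] := leqP a w.
  by rewrite -natrB // -natrX -natrM ler_nat; nia.
by rewrite -sqrrN opprB -natrB 1?ltnW // -natrX -natrM ler_nat; nia.
Qed.

Lemma edge_prod_le_exp (R : realType) (n s a b : nat) (G : multigraph 'I_n)
    (kappa := 1 + (4 * a * a.+1)%:R^-1 :> R) :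
  (0 < a)%N -> (2 <= s <= n)%N -> (b <= s - 2)%N ->
  sq_graph s (a * 'C(s, 2) + b) G ->
  (edge_prod G)%:R * kappa ^+ edit_distance G (U_graph a n) <=
    a%:R ^+ 'C(n, 2) * expR (extra b n)%:R.
Proof.
move=> a0 sn bs GF; have a0R : 0 < a%:R :> R by rewrite ltr0n.
have k0 : 0 < kappa by rewrite ltr_wpDr // invr_ge0 ler0n.
have -> : kappa ^+ edit_distance G (U_graph a n) =
    \prod_e (if G e == a then 1 else kappa).
  rewrite (eq_bigr (fun e => if G e != a then kappa else 1)); last first.
    by move=> e _; case: eqP.
  rewrite -big_mkcond prodr_const; congr (_ ^+ _).
  by apply: eq_card => e; rewrite !inE ffunE.
rewrite /edge_prod natr_prod -big_split /=.
have : \prod_e ((G e)%:R * (if G e == a then 1 else kappa)) <=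
    \prod_(e : vpair 'I_n) (a%:R * expR (((G e)%:R - a%:R) / a%:R)) :> R.
  apply: ler_prod => e _; rewrite mult_le_exp // andbT mulr_ge0 //.
  by case: ifP => // _; exact: ltW.
move=> /le_trans; apply.
rewrite big_split /= prodr_const card_vpair card_ord ler_pM2l ?exprn_gt0 //.
rewrite -expR_sum ler_expR -mulr_suml sumrB -natr_sum sumr_const card_vpair card_ord.
have := sq_graph_edge_sum s a b G; rewrite card_ord => /(_ sn bs GF) h.
rewrite ler_pdivrMr // lerBlDr -mulrnA -natrM -natrD ler_nat.
by apply: leq_trans h _; rewrite addnC leq_add2r leq_pmulr.
Qed.

Lemma extra_le (b n : nat) : (extra b n <= n)%N.
Proof. by rewrite -[leqRHS](mulKn n (ltn0Sn b)) leq_div2r // leq_mul. Qed.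

(** * The case b = 0, the limit and stability *)

Lemma U_graph_sq (n s a b : nat) : sq_graph s (a * 'C(s, 2) + b) (U_graph a n).
Proof.
move=> X Xs; rewrite /edge_sum; under eq_bigr do rewrite ffunE.
by rewrite sum_nat_const card_vpair_sub Xs mulnC leq_addr.
Qed.

Lemma edge_prod_U_graph (n a : nat) : edge_prod (U_graph a n) = (a ^ 'C(n, 2))%N.
Proof.
rewrite /edge_prod; under eq_bigr do rewrite ffunE.
by rewrite prod_nat_const card_vpair card_ord.
Qed.

Lemma ex_prod_ge (n s a b : nat) : (2 <= s <= n)%N ->
  (a ^ 'C(n, 2) <= ex_prod n s (a * 'C(s, 2) + b))%N.
Proof.
move=> sn; rewrite -edge_prod_U_graph.
by have [_] := ex_prod_max (a * 'C(s, 2) + b) sn; apply; exact: U_graph_sq.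
Qed.

Lemma ex_prod_le (R : realFieldType) (n s a b : nat) :
  (0 < a)%N -> (2 <= s <= n)%N -> (b <= s - 2)%N ->
  (ex_prod n s (a * 'C(s, 2) + b))%:R <=
    a%:R ^+ 'C(n, 2) * (a.+1%:R / a%:R) ^+ extra b n :> R.
Proof.
move=> a0 sn bs; have [[G GF <-] _] := ex_prod_max (a * 'C(s, 2) + b) sn.
by have := sq_graph_edge_prod R 'I_n s a b G a0; rewrite card_ord => /(_ sn bs GF)[].
Qed.

Lemma ex_prod_le_exp (R : realType) (n s a b : nat) :
  (0 < a)%N -> (2 <= s <= n)%N -> (b <= s - 2)%N ->
  (ex_prod n s (a * 'C(s, 2) + b))%:R <= a%:R ^+ 'C(n, 2) * expR n%:R :> R.
Proof.
move=> a0 sn bs; have [[G GF <-] _] := ex_prod_max (a * 'C(s, 2) + b) sn.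
apply: le_trans (_ : a%:R ^+ 'C(n, 2) * expR (extra b n)%:R <= _); last first.
  by rewrite ler_pM2l ?exprn_gt0 ?ltr0n // ler_expR ler_nat extra_le.
apply: le_trans (edge_prod_le_exp R n s a b G a0 sn bs GF).
by rewrite ler_peMr // exprn_ege1 // lerDl.
Qed.

Lemma extremal_graphs_U (n s a : nat) : (0 < a)%N -> (2 <= s <= n)%N ->
  ex_prod n s (a * 'C(s, 2) + 0) = (a ^ 'C(n, 2))%N /\
  extremal_graphs n s (a * 'C(s, 2) + 0) = [set U_graph a n]%classic.
Proof.
move=> a0 sn; have ex0 : ex_prod n s (a * 'C(s, 2) + 0) = (a ^ 'C(n, 2))%N.
  apply/eqP; rewrite eqn_leq ex_prod_ge // andbT.
  have := ex_prod_le rat n s a 0 a0 sn (leq0n _).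
  by rewrite /extra mul0n div0n expr0 mulr1 -natrX ler_nat.
split=> //; apply/seteqP; split=> [G [GF GP]|G ->] /=; last first.
  by split; [exact: U_graph_sq | rewrite edge_prod_U_graph ex0].
have := sq_graph_edge_prod rat 'I_n s a 0 G a0.
rewrite card_ord => /(_ sn (leq0n _) GF) /eq_leif.
rewrite GP ex0 /extra mul0n div0n expr0 mulr1 natrX eqxx addn0 => /esym/andP[Gaa].
have Ga e : (a <= G e)%N by move/forallP: Gaa => /(_ e)/orP[]/eqP ->.
have -> : (a * 'C(n, 2))%N = (\sum_(e : vpair 'I_n) a)%N.
  by rewrite sum_nat_const card_vpair card_ord mulnC.
rewrite eq_sym => /eqP Gsum; apply/ffunP => e; rewrite ffunE.
have := @leqif_sum (vpair 'I_n) xpredT (fun e => a == G e) (fun=> a) G.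
case=> [i _|_]; first exact: leqif_eq.
by rewrite Gsum eqxx => /esym/forallP/(_ e)/eqP.
Qed.

Lemma powR_exprn (R : realType) (x r : R) (n : nat) :
  0 < x -> (x ^+ n) `^ r = expR (r * (n%:R * ln x)).
Proof.
move=> x0; rewrite /powR gt_eqF ?exprn_gt0 // lnXn //.
by rewrite [in RHS]mulr_natl.
Qed.

Lemma ex_prod_root_bounds (R : realType) (n s a b : nat) :
  (0 < a)%N -> (2 <= s <= n)%N -> (b <= s - 2)%N ->
  a%:R <= ex_prod_root R s (a * 'C(s, 2) + b) n <=
    a%:R * expR (n%:R / 'C(n, 2)%:R).
Proof.
move=> a0 sn bs; have a0R : 0 < a%:R :> R by rewrite ltr0n.
have N0 : 0 < 'C(n, 2)%:R :> R by rewrite ltr0n bin_gt0; lia.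
have aN : (a%:R ^+ 'C(n, 2)) `^ 'C(n, 2)%:R^-1 = a%:R :> R.
  by rewrite -powR_mulrn ?ler0n // -powRrM divff ?gt_eqF // powRr1 // ler0n.
rewrite -{1}aN; apply/andP; split.
  by rewrite ge0_ler_powR ?nnegrE ?invr_ge0 ?exprn_ge0 // -natrX ler_nat ex_prod_ge.
have := ex_prod_le_exp R n s a b a0 sn bs.
move=> /(ge0_ler_powR _ _) -/(_ 'C(n, 2)%:R^-1); rewrite !nnegrE => h.
apply: le_trans (h _ _ _) _; rewrite ?invr_ge0 ?mulr_ge0 ?exprn_ge0 ?expR_ge0 //.
by rewrite powRM ?exprn_ge0 ?expR_ge0 // aN expRM.
Qed.

Lemma ex_prod_root_cvg (R : realType) (s a b : nat) :
  (0 < a)%N -> (2 <= s)%N -> (b <= s - 2)%N ->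
  (ex_prod_root R s (a * 'C(s, 2) + b) n @[n --> \oo] --> (a%:R : R))%classic.
Proof.
move=> a0 s2 bs.
apply: (@squeeze_cvgr _ _ _ _ (fun=> a%:R) (fun n => a%:R * expR (4 * harmonic n))).
- near=> n.
  have sn : (s <= n)%N by near: n; exact: nbhs_infty_ge.
  have n3 : (3 <= n)%N by near: n; exact: nbhs_infty_ge.
  have sn' : (2 <= s <= n)%N by rewrite s2.
  have /andP[h1 h] := ex_prod_root_bounds R n s a b a0 sn' bs; rewrite h1 /=.
  apply: le_trans h _; rewrite ler_pM2l ?ltr0n // ler_expR.
  rewrite ler_pdivrMr ?ltr0n ?bin_gt0 1?ltnW // mulrAC ler_pdivlMr ?ltr0n //.
  rewrite -!natrM ler_nat bin2; have := odd_double_half (n * n.-1).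
  have -> : odd (n * n.-1) = false.
    by rewrite oddM -subn1 oddB ?(ltnW (ltnW n3)) //= addbT andbN.
  by rewrite -mul2n add0n; nia.
- exact: cvg_cst.
- have h : (4 * (harmonic n : R) @[n --> \oo] --> (4 * 0 : R))%classic.
    by apply: cvgM; [exact: cvg_cst | exact: cvg_harmonic].
  have e := continuous_cvg _ (@continuous_expR R (4 * 0)) h.
  have : (a%:R * expR (4 * harmonic n) @[n --> \oo] --> (a%:R * expR (4 * 0) : R))%classic.
    by apply: cvgM; [exact: cvg_cst | exact: e].
  by rewrite mulr0 expR0 mulr1.
Unshelve. all: by end_near.
Qed.

(** With D the edit distance, the two bounds on the product give
    D ln kappa <= n + eps N ln a; eps and M are chosen so that each of the two
    terms on the right is at most delta ln kappa n^2 / 2. *)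
Lemma ex_prod_stability (R : realType) (s a b : nat) (delta : R) :
  (0 < a)%N -> (2 <= s)%N -> (b <= s - 2)%N -> 0 < delta ->
  exists (eps : R) (M : nat), 0 < eps /\
    forall n : nat, (M < n)%N ->
    forall G : multigraph 'I_n, sq_graph s (a * 'C(s, 2) + b) G ->
      (ex_prod n s (a * 'C(s, 2) + b))%:R `^ (1 - eps) < (edge_prod G)%:R ->
      delta_close delta G (U_graph a n).
Proof.
move=> a0 s2 bs d0; have a0R : 0 < a%:R :> R by rewrite ltr0n.
pose kappa : R := 1 + (4 * a * a.+1)%:R^-1.
have k1 : 1 < kappa by rewrite ltrDl invr_gt0 ltr0n !muln_gt0 a0.
have lk0 : 0 < ln kappa by rewrite ln_gt0.
have la0 : 0 <= ln a%:R :> R by rewrite ln_ge0 // ler1n.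
pose x := delta * ln kappa; have x0 : 0 < x by rewrite mulr_gt0.
pose eps := Num.min 1 (x / (ln a%:R + 1)).
have eps0 : 0 < eps by rewrite lt_min ltr01 divr_gt0 // ltr_wpDl.
have epsa : eps * ln a%:R <= x.
  apply: le_trans (_ : x / (ln a%:R + 1) * ln a%:R <= _).
    by rewrite ler_wpM2r // ge_min lexx orbT.
  by rewrite mulrAC ler_pdivrMr ?ltr_wpDl // ler_pM2l // lerDl.
exists eps, (maxn s (Num.bound (2 / x))); split=> // n.
rewrite gtn_max => /andP[sn Mn] G GF Glarge.
have sn' : (2 <= s <= n)%N by rewrite s2 ltnW.
have nx : 2 <= n%:R * x.
  rewrite -ler_pdivrMr // ltW //; apply: lt_trans (_ : (Num.bound (2 / x))%:R < _).
    by rewrite archi_boundP // divr_ge0 // ltW.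
  by rewrite ltr_nat.
rewrite /delta_close card_ord -(ler_pM2r lk0) mulrAC -/x.
set D := edit_distance _ _; set N := 'C(n, 2).
have le1 : expR ((1 - eps) * (N%:R * ln a%:R)) <= (edge_prod G)%:R.
  apply: le_trans (ltW Glarge); rewrite -powR_exprn //.
  rewrite ge0_ler_powR ?nnegrE ?subr_ge0 ?ge_min ?lexx ?exprn_ge0 //.
  by rewrite -natrX ler_nat ex_prod_ge.
have le2 : (edge_prod G)%:R * expR (D%:R * ln kappa) <=
    expR (N%:R * ln a%:R) * expR n%:R.
  have := edge_prod_le_exp R n s a b G a0 sn' bs GF; rewrite -/kappa -/D -/N.
  have kK : expR (D%:R * ln kappa) = kappa ^+ D.
    by rewrite expRM_natl lnK ?posrE // (lt_trans ltr01).
  have aK : expR (N%:R * ln a%:R) = a%:R ^+ N :> R by rewrite expRM_natl lnK.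
  rewrite kK aK => /le_trans; apply.
  by rewrite ler_pM2l ?exprn_gt0 // ler_expR ler_nat extra_le.
have : expR ((1 - eps) * (N%:R * ln a%:R)) * expR (D%:R * ln kappa) <=
    expR (N%:R * ln a%:R) * expR n%:R.
  by apply: le_trans le2; rewrite ler_pM2r ?expR_gt0.
rewrite -!expRD ler_expR => main.
have N2 : N%:R * 2 <= n%:R ^+ 2 :> R.
  rewrite -natrM -natrX ler_nat /N bin2 muln2 -mulnn.
  apply: (@leq_trans (n * n.-1)); last by rewrite leq_mul // leq_pred.
  by rewrite -[leqRHS]odd_double_half leq_addl.
have NE : eps * (N%:R * ln a%:R) <= N%:R * x.
  by rewrite mulrCA ler_wpM2l.
have nn : n%:R * 2 <= n%:R * (n%:R * x) by rewrite ler_wpM2l.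
have : N%:R * 2 * x <= n%:R ^+ 2 * x by rewrite ler_wpM2r // ltW.
move: main NE nn; set A := N%:R * ln a%:R; set B := N%:R * x.
rewrite mulrA -expr2 [N%:R * 2 * x]mulrAC -/B [_ * x]mulrC; lra.
Qed.

(** * Disjoint unions of stars *)

(** The pair e has the form {x, h x} with h x <> x: for an idempotent h sending
    each vertex to the centre of its block, these are the edges of the spanning
    stars of the blocks. *)
Definition star_pair {T : finType} (h : T -> T) (e : vpair T) : bool :=
  [exists x in val e, (h x \in val e) && (h x != x)].

(** Multiplicity a + 1 on the star edges of h, and a elsewhere. *)
Definition star_graph {T : finType} (a : nat) (h : T -> T) : multigraph T :=
  [ffun e => (a + star_pair h e)%N].

Lemma card_star_pair {T : finType} (h : T -> T) (X : {set T}) :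
  (forall x, h (h x) = h x) ->
  #|[pred e : vpair T | (val e \subset X) && star_pair h e]| =
  #|[set x in X | (h x \in X) && (h x != x)]%SET|.
Proof.
move=> hh; rewrite -(card_imset _ val_inj).
rewrite -(@card_in_imset _ _ (fun x => [set x; h x]%SET)); last first.
  move=> x y; rewrite !inE => /and3P[_ _ hx] /and3P[_ _ hy] /setP E.
  have := E x; rewrite !inE eqxx /= => /esym/orP[/eqP//|/eqP xy].
  by move: hx; rewrite xy hh eqxx.
apply: eq_card => B; apply/imsetP/imsetP => [[e]|[x]].
  rewrite !inE => /andP[eX /exists_inP[x xe /andP[hxe hx]]] ->.
  exists x; first by rewrite inE !(fintype.subsetP eX) ?hx.
  apply/esym/eqP; rewrite eqEcard (eqP (valP e)) finset.cards2 eq_sym hx leqnn andbT.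
  by apply/fintype.subsetP => y /[!inE] /orP[]/eqP ->.
rewrite inE => /and3P[xX hX hx] ->.
have c2 : #|[set x; h x]%SET| == 2%N by rewrite finset.cards2 [x == _]eq_sym hx.
exists (Sub [set x; h x]%SET c2); last by rewrite SubK.
rewrite inE SubK finset.subUset !finset.sub1set xX hX /=.
by apply/exists_inP; exists x; rewrite SubK !inE eqxx ?orbT.
Qed.

(** Let X have b + 2 vertices and F be the set of centres in X.  The star edges
    in X correspond to vertices of X outside F.  If F has two elements, there
    are at most b of them; if F has one, they all lie in a single fibre with
    their centre; if F is empty there are none. *)
Lemma star_graph_sq {T : finType} (a b : nat) (h : T -> T) :
  (forall x, h (h x) = h x) ->
  (forall c, (#|[set x | h x == c]%SET| <= b.+1)%N) ->
  sq_graph b.+2 (a * 'C(b.+2, 2) + b) (star_graph a h).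
Proof.
move=> hh fib X Xs; rewrite /edge_sum; under eq_bigr do rewrite ffunE.
rewrite big_split /= sum_nat_const card_vpair_sub Xs mulnC leq_add2l.
rewrite -big_mkcondr /= sum1_card card_star_pair //.
set Z := finset _; set F := [set x in X | h x == x]%SET.
have disj : (#|Z| + #|F| <= b.+2)%N.
  rewrite -Xs -(cardsID F X) addnC leq_add ?subset_leq_card //.
    by apply/fintype.subsetP => x; rewrite !inE => /andP[-> ->].
  by apply/fintype.subsetP => x; rewrite !inE => /and3P[-> _ /negbTE ->].
have [F1|F2] := leqP #|F| 1; last by lia.
have [Z0|/set0Pn[x xZ]] := eqVneq Z finset.set0; first by rewrite Z0 finset.cards0.
have inF y : y \in Z -> h y \in F by rewrite !inE hh eqxx andbT => /and3P[].
have sub : h x |: Z \subset [set y | h y == h x]%SET.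
  apply/fintype.subsetP => y; rewrite !inE => /orP[/eqP ->|yZ]; first by rewrite hh.
  have yZ' : y \in Z by rewrite inE.
  by apply/eqP; apply: (card_le1_eqP F1); exact: inF.
have := leq_trans (subset_leq_card sub) (fib (h x)).
by rewrite cardsU1 inE hh eqxx !andbF.
Qed.

Lemma edge_prod_star_graph (R : realFieldType) {T : finType} (a : nat) (h : T -> T) :
  (0 < a)%N -> (forall x, h (h x) = h x) ->
  (edge_prod (star_graph a h))%:R = a%:R ^+ 'C(#|T|, 2) *
    (a.+1%:R / a%:R) ^+ #|[set x | h x != x]%SET| :> R.
Proof.
move=> a0 hh; have a0R : 0 < a%:R :> R by rewrite ltr0n.
pose c : R := a.+1%:R / a%:R.
rewrite /edge_prod natr_prod.
rewrite (eq_bigr (fun e => a%:R * (if star_pair h e then c else 1))); last first.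
  move=> e _; rewrite ffunE; case: star_pair; last by rewrite mulr1 addn0.
  by rewrite addn1 /c mulrCA divff ?gt_eqF // mulr1.
rewrite big_split /= prodr_const card_vpair -big_mkcond prodr_const; congr (_ * _ ^+ _).
transitivity #|[pred e : vpair T | (val e \subset finset.setT) && star_pair h e]|.
  by apply: eq_card => e; rewrite !inE finset.subsetT.
by rewrite card_star_pair //; apply: eq_card => x; rewrite !inE.
Qed.

(** A star graph with few enough centres meets the upper bound on products. *)
Lemma star_graph_extremal (R : realFieldType) (n a b : nat) (h : 'I_n -> 'I_n) :
  (0 < a)%N -> (b.+2 <= n)%N ->
  (forall x, h (h x) = h x) ->
  (forall c, (#|[set x | h x == c]%SET| <= b.+1)%N) ->
  (#|[set x | h x == x]%SET| + extra b n <= n)%N ->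
  extremal_graphs n b.+2 (a * 'C(b.+2, 2) + b) (star_graph a h) /\
  (ex_prod n b.+2 (a * 'C(b.+2, 2) + b))%:R =
    a%:R ^+ 'C(n, 2) * (a.+1%:R / a%:R) ^+ extra b n :> R.
Proof.
move=> a0 bn hh fib fixed; have GF := star_graph_sq a b h hh fib.
have up := ex_prod_le R n b.+2 a b a0 bn _.
have [_ /(_ _ GF) low] := ex_prod_max (a * 'C(b.+2, 2) + b) (bn : 2 <= b.+2 <= n)%N.
have le : a%:R ^+ 'C(n, 2) * (a.+1%:R / a%:R) ^+ extra b n <=
    (edge_prod (star_graph a h))%:R :> R.
  rewrite edge_prod_star_graph // card_ord ler_pM2l ?exprn_gt0 ?ltr0n //.
  rewrite ler_eXn2l ?ltr_pdivlMr ?ltr0n ?mul1r ?ltr_nat //.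
  have := cardsC [set x | h x == x]%SET; rewrite card_ord.
  have -> : (~: [set x | h x == x] = [set x | h x != x])%SET.
    by apply/setP => x; rewrite !inE.
  by move=> cn; rewrite -(leq_add2l #|[set x | h x == x]%SET|) cn.
have lowR : (edge_prod (star_graph a h))%:R <=
   (ex_prod n b.+2 (a * 'C(b.+2, 2) + b))%:R :> R by rewrite ler_nat.
have upR := up _; rewrite !subSS subn0 in upR.
split; last by apply/eqP; rewrite eq_le upR //= (le_trans le).
split=> //; apply/eqP; rewrite eqn_leq low /= -(ler_nat R).
exact: le_trans (upR (leqnn b)) le.
Qed.

(** The number of blocks, ceil (n / (b + 1)), plus the extremal excess is at
    most n. *)
Lemma extra_ceil (b n : nat) :
  (n %/ b.+1 + (0 < n %% b.+1) + extra b n <= n)%N.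
Proof.
have := leqnn (extra b n); rewrite {1}leq_extra.
have := divn_eq n b.+1; move: (n %/ b.+1)%N (n %% b.+1)%N (extra b n) => k t f nE.
by have [t0|t0] := posnP t; nia.
Qed.

Lemma card_fixed_le {T I : finType} (h : T -> T) (blk : T -> I) (A : {pred I}) :
  (forall x y, blk x = blk y -> h x = h y) -> (forall x, blk x \in A) ->
  (#|[set x | h x == x]%SET| <= #|A|)%N.
Proof.
move=> hblk blkA; rewrite -(@card_in_imset _ _ blk).
  by apply: subset_leq_card; apply/fintype.subsetP => _ /imsetP[x _ ->].
by move=> x y; rewrite !inE => /eqP xx /eqP yy /hblk; rewrite xx yy.
Qed.

(** The blocks are the intervals of length b + 1, centred at their first
    element. *)
Lemma exists_star_fun (n b : nat) : exists h : 'I_n -> 'I_n,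
  [/\ forall x, h (h x) = h x, forall c, (#|[set x | h x == c]%SET| <= b.+1)%N
    & (#|[set x | h x == x]%SET| + extra b n <= n)%N].
Proof.
have lt (x : 'I_n) : (x %/ b.+1 * b.+1 < n)%N.
  exact: leq_ltn_trans (leq_divM _ _) (ltn_ord x).
exists (fun x => Ordinal (lt x)); split.
- by move=> x; apply: val_inj; rewrite /= mulnK.
- move=> c; rewrite -[leqRHS]card_ord.
  rewrite -(@card_in_imset _ _ (fun x : 'I_n => inord (x %% b.+1) : 'I_b.+1)).
    exact: max_card.
  move=> x y; rewrite !inE -!val_eqE /= => /eqP xc /eqP yc /(congr1 val).
  rewrite /= !inordK ?ltn_mod // => xy; apply: val_inj => /=.
  by rewrite (divn_eq x b.+1) xc xy -yc -divn_eq.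
have ltK (x : 'I_n) : (x %/ b.+1 < n %/ b.+1 + (0 < n %% b.+1))%N.
  rewrite ltn_divLR // mulnDl; have := divn_eq n b.+1; have := ltn_ord x.
  have : (n %% b.+1 < b.+1)%N by rewrite ltn_mod.
  move: (n %/ b.+1 * b.+1)%N (n %% b.+1)%N => k t; case: t => [|t]; lia.
apply: leq_trans (extra_ceil b n); rewrite leq_add2r -[leqRHS]card_ord.
apply: (card_fixed_le _ (fun x => Ordinal (ltK x))) => // x y [xy].
by apply: val_inj; rewrite /= xy.
Qed.

Lemma U_graph_is_star (n b a : nat) (G : multigraph 'I_n) :
  (0 < n)%N -> U_graphs b.+1 a n G ->
  exists h : 'I_n -> 'I_n,
  [/\ G = star_graph a h, forall x, h (h x) = h x,
      forall c, (#|[set x | h x == c]%SET| <= b.+1)%N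
    & (#|[set x | h x == x]%SET| + extra b n <= n)%N].
Proof.
move=> n0 [A [[disj cov] [A0 Ar] star other]].
have ctrP i : exists c : 'I_n, A i != finset.set0 -> c \in A i /\
    forall e : vpair 'I_n, val e \subset A i -> G e = if c \in val e then a.+1 else a.
  have [E|/star[c cA Gc]] := eqVneq (A i) finset.set0; last by exists c.
  by exists (Ordinal n0).
have [ctr {}ctrP] := choice ctrP; have [blk blkP] := choice cov.
have blkE x i : x \in A i -> blk x = i.
  move=> xi; apply/eqP; apply: contraT => /disj/setP/(_ x).
  by rewrite !inE blkP xi.
have An0 x : A (blk x) != finset.set0 by apply/set0Pn; exists x.
have ctrA x : ctr (blk x) \in A (blk x) by have [] := ctrP _ (An0 x).
have blk_ctr x : blk (ctr (blk x)) = blk x by apply: blkE.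
have A0E : #|A ord0| = (n %% b.+1)%N by rewrite A0 {1}(divn_eq n b.+1) mulnC addKn.
exists (ctr \o blk); split=> [||c|] /=.
- apply/ffunP => e; rewrite ffunE; have [x [y [xy eE]]] := vpairP e.
  have [bxy|bxy] := eqVneq (blk x) (blk y); last first.
    rewrite other => [|i]; last first.
      apply/negP; rewrite eE finset.subUset !finset.sub1set => /andP[/blkE xi /blkE yi].
      by move: bxy; rewrite xi yi eqxx.
    suff -> : star_pair (ctr \o blk) e = false by rewrite addn0.
    apply/exists_inP => -[z]; rewrite /= eE !inE => ze /andP[/orP[]/eqP cz cz'].
      move/(congr1 blk): (cz); rewrite blk_ctr => zx.
      case/orP: ze => /eqP zE; first by move: cz'; rewrite cz zE eqxx.
      by move: bxy; rewrite -zx zE eqxx.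
    move/(congr1 blk): (cz); rewrite blk_ctr => zx.
    case/orP: ze => /eqP zE; last by move: cz'; rewrite cz zE eqxx.
    by move: bxy; rewrite -zx zE eqxx.
  have [_ /(_ e) ->] := ctrP _ (An0 x); last first.
    by rewrite eE finset.subUset !finset.sub1set blkP bxy blkP.
  suff -> : star_pair (ctr \o blk) e = (ctr (blk x) \in val e).
    by case: (_ \in _); rewrite ?addn1 ?addn0.
  apply/exists_inP/idP => [[z]|].
    rewrite eE !inE => ze /andP[/= hz _]; move: ze hz.
    by case/orP => /eqP -> ; rewrite ?bxy.
  move=> ce; have [cx|cx] := eqVneq (ctr (blk x)) x.
    by exists y; rewrite ?eE ?inE ?eqxx ?orbT //= -bxy cx eqxx.
  by exists x; rewrite ?cx ?ce // eE !inE eqxx.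
- by move=> x; rewrite blk_ctr.
- have [->|/set0Pn[x]] := eqVneq [set x | ctr (blk x) == c]%SET finset.set0.
    by rewrite finset.cards0.
  rewrite inE => /eqP xc; apply: (@leq_trans #|A (blk x)|).
    apply: subset_leq_card; apply/fintype.subsetP => y; rewrite inE => /eqP yc.
    by rewrite -(blk_ctr x) xc -yc blk_ctr.
  have [->|/Ar ->//] := eqVneq (blk x) ord0.
  by rewrite A0E ltnW // ltn_mod.
apply: leq_trans (extra_ceil b n); rewrite leq_add2r.
have hb x y : blk x = blk y -> ctr (blk x) = ctr (blk y) by move=> ->.
(* The centres inject into the non-empty blocks, and A ord0 is empty exactly
   when b.+1 divides n. *)
have [r0|r0] := posnP (n %% b.+1).
  apply: (@leq_trans #|predC1 (ord0 : 'I_(n %/ b.+1).+1)|); last first.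
    by rewrite cardC1 card_ord addn0.
  apply: (card_fixed_le _ blk _ hb) => x; rewrite inE.
  by apply/eqP => bx; have := An0 x; rewrite bx -card_gt0 A0E r0.
apply: (@leq_trans #|'I_(n %/ b.+1).+1|); last by rewrite card_ord addn1.
exact: (card_fixed_le _ blk _ hb).
Qed.

(** * Extremal graphs for s = 3 *)

Lemma extremal_graphs3 (n a : nat) (G : multigraph 'I_n) :
  (0 < a)%N -> (3 <= n)%N ->
  extremal_graphs n 3 (a * 'C(3, 2) + 1) G -> U_graphs 2 a n G.
Proof.
move=> a0 n3 [GF GP].
have [h [hh fib fixed]] := exists_star_fun n 1.
have [_ exE] := star_graph_extremal rat n a 1 h a0 n3 hh fib fixed.
have := sq_graph_edge_prod rat 'I_n 3 a 1 G a0; rewrite card_ord.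
move=> /(_ n3 isT GF) /eq_leif; rewrite GP exE eqxx => /esym/andP[/forallP Gaa /eqP Gsum].
have half : extra 1 n = (n %/ 2)%N by rewrite /extra mul1n.
pose M := [set e : vpair 'I_n | G e == a.+1]%SET.
have GE e : G e = (a + (e \in M))%N.
  by rewrite inE; case/orP: (Gaa e) => /eqP ->; rewrite ?eqxx ?addn1 ?ltn_eqF ?addn0.
have cM : #|M| = (n %/ 2)%N.
  move: Gsum; under eq_bigr do rewrite GE.
  rewrite big_split /= sum_nat_const card_vpair card_ord mulnC => /addnI.
  by rewrite half => <-; rewrite -sum1_card big_mkcond.
have ex1 e : e \in M -> excess a G e = 1 by rewrite /excess GE => ->; lia.
(* Two pairs of M sharing a vertex would span a 3-set of excess at least 2. *)
have matching e f : e \in M -> f \in M -> e != f -> val e :&: val f = finset.set0.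
  move=> eM fM ef; apply/eqP; apply: contraT => /set0Pn[x]; rewrite inE => /andP[xe xf].
  exfalso.
  have I0 : (0 < #|val e :&: val f|)%N.
    by rewrite card_gt0; apply/set0Pn; exists x; rewrite inE xe.
  have I2 : (#|val e :&: val f| < 2)%N.
    rewrite ltnNge; apply/negP => c2.
    have := finset.subsetIl (val e) (val f); have := finset.subsetIr (val e) (val f).
    move=> If Ie; move: ef; rewrite -(inj_eq val_inj) => /eqP; apply.
    have /eqP <- : val e :&: val f == val e by rewrite eqEcard Ie (eqP (valP e)).
    by apply/eqP; rewrite eqEcard If (eqP (valP f)).
  have c3 : #|val e :|: val f| = 3%N.
    rewrite cardsU (eqP (valP e)) (eqP (valP f)).
    by move: I0 I2; case: #|_| => [|[]].
  have := pair_sum_excess_le 3 a 1 G GF _ c3.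
  rewrite /pair_sum (bigD1 e) ?finset.subsetUl //= (bigD1 f) /=; last first.
    by rewrite finset.subsetUr eq_sym.
  have : 0 <= \sum_(i : vpair 'I_n |
      (val i \subset val e :|: val f) && (i != e) && (i != f)) excess a G i.
    by apply: sumr_ge0 => i _; rewrite /excess GE PoszD addrAC subrr add0r.
  by move=> r0; rewrite !ex1 // addrA => /(le_trans (lerD (lexx (1 + 1)) r0)).
pose V : {set {set 'I_n}} := [set val e | e in M]%SET; pose C := finset.cover V.
have cC : #|C| = (2 * (n %/ 2))%N.
  have triv : finset.trivIset V.
    apply/finset.trivIsetP => _ _ /imsetP[e eM ->] /imsetP[f fM ->] ef.
    by rewrite -finset.setI_eq0 matching.
  rewrite /C -(eqP triv) -cM -(card_imset _ val_inj) mulnC -sum_nat_const.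
  by apply: eq_bigr => _ /imsetP[e _ ->]; rewrite (eqP (valP e)).
have szM : size (enum M) = (n %/ 2)%N by rewrite -cardE.
have n2 : (0 < n %/ 2)%N by rewrite divn_gt0 //; lia.
have /card_gt0P[e0 e0M] : (0 < #|M|)%N by rewrite cM.
pose ed (i : nat) := nth e0 (enum M) i.
have edM i : (i < n %/ 2)%N -> ed i \in M.
  by move=> ltin; rewrite -mem_enum mem_nth ?szM.
have edI i j : (i < n %/ 2)%N -> (j < n %/ 2)%N -> ed i = ed j -> i = j.
  by move=> li lj /eqP; rewrite nth_uniq ?szM ?enum_uniq // => /eqP.
have edC i : (i < n %/ 2)%N -> val (ed i) \subset C.
  by move=> li; apply: (finset.bigcup_max (val (ed i))) => //; apply: imset_f; exact: edM.
(* Blocks 1 to n %/ 2 are the pairs of the matching; block 0 consists of the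
   uncovered vertices. *)
pose A (i : 'I_(n %/ 2).+1) : {set 'I_n} :=
  if (i : nat) is j.+1 then val (ed j) else ~: C.
exists A; split.
- split=> [i j|x].
    wlog: i j / (i < j)%N => [hw ij|].
      have [lt|lt|eq] := ltngtP i j; first exact: hw.
        by rewrite finset.setIC; apply: hw; rewrite // eq_sym.
      by move: ij; rewrite (val_inj eq) eqxx.
    case: i j => -[|i] li [[|j] lj] //= ij _; rewrite /A /=.
      apply/eqP; rewrite finset.setI_eq0 disjoint_sym finset.disjoints_subset finset.setCK.
      exact: edC.
    by apply: matching; rewrite ?edM //; apply/eqP => /edI E; move: ij; rewrite E ?ltnn.
  have [xC|xC] := boolP (x \in C); last first.
    by exists ord0; rewrite /A /= inE.
  have /finset.bigcupP[_ /imsetP[e eM ->] xe] := xC.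
  have ie : (index e (enum M) < n %/ 2)%N by rewrite -szM index_mem mem_enum.
  exists (Ordinal (ie : (index e (enum M)).+1 < (n %/ 2).+1)%N); rewrite /A /= /ed nth_index //.
  by rewrite mem_enum.
- split=> [|[[|j] lj]] //; last by move=> _; rewrite /A /= (eqP (valP (ed j))).
  by rewrite /A /= cardsCs finset.setCK card_ord cC.
- case=> -[|j] lj; rewrite /A /= => Ai.
    have {Ai} /set0Pn[c cC'] := Ai; exists c => // e sub.
    (* ~: C has at most one element, so it contains no pair. *)
    exfalso; have := subset_leq_card sub.
    rewrite (eqP (valP e)) cardsCs finset.setCK card_ord cC.
    have := divn_eq n 2; have : (n %% 2 < 2)%N by rewrite ltn_mod.
    by move: (n %/ 2)%N (n %% 2)%N; lia.
  have [x [y [xy edE]]] := vpairP (ed j); exists x; first by rewrite edE !inE eqxx.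
  move=> e sub; have -> : e = ed j.
    by apply/val_inj/eqP; rewrite eqEcard sub (eqP (valP e)) (eqP (valP (ed j))).
  rewrite edE !inE eqxx /=; have := edM j lj; rewrite inE => /eqP; exact.
- move=> e noA; rewrite GE; have [eM|_] := boolP (e \in M); last by rewrite addn0.
  have ie : (index e (enum M) < n %/ 2)%N by rewrite -szM index_mem mem_enum.
  have := noA (Ordinal (ie : (index e (enum M)).+1 < (n %/ 2).+1)%N).
  by rewrite /A /= /ed nth_index ?mem_enum // fintype.subxx.
Qed.

Theorem theorem3 (R : realType) (s q a b : nat)
    (hs : (2 <= s)%N) (ha : (1 <= a)%N)
    (hq : q = (a * 'C(s, 2) + b)%N) (hb : (b <= s - 2)%N) :
  [/\ (* Extremal *)
      (forall n : nat, (s <= n)%N ->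
        [/\ a%:R ^+ 'C(n, 2) <= (ex_prod n s q)%:R :> R,
            (ex_prod n s q)%:R <=
              a%:R ^+ 'C(n, 2) * (a.+1%:R / a%:R) ^+ ((b * n) %/ b.+1) :> R,
            (* (a) *)
            (b = 0%N ->
              extremal_graphs n s q = [set U_graph a n] /\
              ex_prod n s q = (a ^ 'C(n, 2))%N)
          & (* (b) *)
            (b = (s - 2)%N ->
              [/\ U_graphs (s - 1) a n `<=` extremal_graphs n s q,
                  (ex_prod n s q)%:R =
                    a%:R ^+ 'C(n, 2) *
                      (a.+1%:R / a%:R) ^+ (((s - 2) * n) %/ (s - 1)) :> R
                & s = 3%N -> extremal_graphs n 3 q = U_graphs 2 a n])]),
      cvgn (ex_prod_root R s q) /\ ex_prod_limit R s q = a%:R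
    & (* Stability *)
      (forall delta : R, 0 < delta ->
        exists (eps : R) (M : nat), 0 < eps /\
          forall n : nat, (M < n)%N ->
            forall G : multigraph 'I_n, sq_graphs n s q G ->
              (ex_prod n s q)%:R `^ (1 - eps) < (edge_prod G)%:R ->
              delta_close delta G (U_graph a n))].
Proof.
have sn n : (s <= n)%N -> (2 <= s <= n)%N by rewrite hs.
rewrite hq; split.
- move=> n /sn sn'; split.
  + by rewrite -natrX ler_nat; exact: ex_prod_ge.
  + exact: ex_prod_le.
  + by move=> b0; rewrite b0; have [exU extU] := extremal_graphs_U n s a ha sn'.
  + move=> bs; have {bs} sE : s = b.+2 by lia.
    rewrite sE in sn' *; have {sn'} [_ bn] := andP sn'.
    rewrite subn1 !subSS subn0 /=.
    have [h [hh fib fixed]] := exists_star_fun n b.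
    have [_ exE] := star_graph_extremal R n a b h ha bn hh fib fixed.
    split=> [G|//|[b1]].
      case/(U_graph_is_star n b a G (leq_ltn_trans (leq0n _) bn)) => g [-> gg gfib gfixed].
      by have [] := star_graph_extremal R n a b g ha bn gg gfib gfixed.
    apply/seteqP; split=> G; rewrite b1 in bn *; first exact: extremal_graphs3.
    case/(U_graph_is_star n 1 a G (leq_ltn_trans (leq0n _) bn)) => g [-> gg gfib gfixed].
    by have [] := star_graph_extremal R n a 1 g ha bn gg gfib gfixed.
- have cvg := ex_prod_root_cvg R s a b ha hs hb; split.
    by apply/cvg_ex; exists a%:R.
  exact: cvg_lim cvg.
- by move=> delta; exact: ex_prod_stability.
Qed.
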